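(* Let $P(t)=\sum_{n\ge0}\gamma_nt^n\in\mathbb{C}[[t]]$ be a tame power series which is finite rationally accumulating of period $h_P\in\mathbb{Z}_{\ge1}$. For $[e]\in\mathbb{Z}/h_P\mathbb{Z}$ let $a^{[e]}=\sum_{k\ge0}a_k^{[e]}s^k\in\Omega(P)$ be the opposite series associated with the rational subset $U^{[e]}=\{n\in\mathbb{Z}_{\ge0}: n\equiv e\bmod h_P\}$. Then $a^{[e]}$ converges to a rational function $$a^{[e]}(s)=\frac{A^{[e]}(s)}{1-A_Ps^{h_P}},$$ where the numerator is the polynomial of degree $h_P-1$ $$A^{[e]}(s):=\sum_{j=0}^{h_P-1}\Big(\prod_{i=1}^{j}a_1^{[e-i+1]}\Big)s^{j}$$ and $$A_P:=\prod_{i=0}^{h_P-1}a_1^{[i]}=a_{h_P}^{[0]}=\cdots=a_{h_P}^{[h_P-1]}.$$ Moreover $(r_P)^{h_P}=(R_P)^{h_P}=|A_P|$.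
   Context: A power series $P(t)=\sum_{n\ge0}\gamma_nt^n\in\mathbb{C}[[t]]$ is tame if there are $u,v\in\mathbb{R}_{>0}$ with $u\le|\gamma_{n-1}/\gamma_n|\le v$ for all sufficiently large $n$. Put $r_P:=1/\limsup_n|\gamma_n|^{1/n}$ (the radius of convergence) and $R_P:=1/\liminf_n|\gamma_n|^{1/n}$. For large $n$ set $X_n(P):=\sum_{k=0}^n\frac{\gamma_{n-k}}{\gamma_n}s^k$. Equip $\mathbb{C}[[s]]$ with the topology of coefficientwise convergence. $\Omega(P)\subset\mathbb{C}[[s]]$ is the set of accumulation points (limits of subsequences) of $\{X_n(P)\}$; its elements are called opposite series. A subset $U\subset\mathbb{Z}_{\ge0}$ is rational if $\sum_{n\in U}t^n$ is a rational function; equivalently, there is $h\in\mathbb{Z}_{>0}$ with ($n+h\in U\iff n\in U$) for all large $n$; the least such $h$ is the period of $U$. A finite rational partition of $\mathbb{Z}_{\ge0}$ is a finite family $\{U_a\}_{a\in\Omega}$ of rational subsets such that for some finite set $D$ one has the disjoint decomposition $\mathbb{Z}_{\ge0}\setminus D=\coprod_a(U_a\setminus D)$; its period is the least common multiple of the periods of the $U_a$. A sequence $\{X_n\}$ in a Hausdorff space is finite rationally accumulating if it accumulates to a finite set $\Omega$ such that, for a system of pairwise disjoint open neighbourhoods $\mathcal{V}_a$ of $a\in\Omega$, the sets $U_a:=\{n: X_n\in\mathcal{V}_a\}$ form a finite rational partition; its period is the period of this partition. $P$ is called finite rationally accumulating of period $h_P$ if the sequence $\{X_n(P)\}$ is.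 In that case $a^{[e]}:=\lim_{n\to\infty,\ n\equiv e\bmod h_P}X_n(P)$ exists for each $[e]\in\mathbb{Z}/h_P\mathbb{Z}$; its coefficients are denoted $a_k^{[e]}$, so $a_1^{[e]}=\lim_{n\equiv e}\gamma_{n-1}/\gamma_n$. *)

(* Defs.v *)
From HB Require Import structures.
From mathcomp Require Import all_boot all_order all_algebra.
From mathcomp Require Import complex.
From mathcomp Require Import all_classical all_reals all_analysis.

Set Implicit Arguments.
Unset Strict Implicit.
Unset Printing Implicit Defensive.

Import Order.TTheory GRing.Theory Num.Theory.
Import numFieldNormedType.Exports.

Local Open Scope classical_set_scope.
Local Open Scope complex_scope.
Local Open Scope ring_scope.

(* A formal power series is its sequence of coefficients. The type
   {ptws nat -> K} carries the product topology, which is the topology of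
   coefficientwise convergence. *)
Definition fps (K : numFieldType) : Type := {ptws nat -> K}.

HB.instance Definition _ (K : numFieldType) :=
  Uniform.copy (fps K) {ptws nat -> K}.
HB.instance Definition _ (K : numFieldType) := Pointed.copy (fps K) (nat -> K).

(* f is the expansion at 0 of the rational function p / q, that is,
   q f = p in the ring of formal power series. *)
Definition fps_quotient (K : fieldType) (f : nat -> K) (p q : {poly K}) : Prop :=
  q != 0 /\ forall k : nat, \sum_(i < k.+1) q`_i * f (k - i)%N = p`_k.

(* f has a positive radius of convergence, and its sum is p / q near 0. *)
Definition fps_converges_to (K : numFieldType) (f : fps K) (p q : {poly K}) :
    Prop :=
  \forall s \near (0 : K),
    series (fun k => f k * s ^+ k) @ \oo --> p.[s] / q.[s].

Definition rational_subset (K : fieldType) (U : set nat) : Prop :=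
  exists p q : {poly K}, fps_quotient (fun n => (n \in U)%:R) p q.

Definition eventually_shift_invariant (U : set nat) (h : nat) : Prop :=
  \forall n \near \oo, U (n + h)%N <-> U n.

Definition has_period (U : set nat) (h : nat) : Prop :=
  [/\ (0 < h)%N, eventually_shift_invariant U h &
      forall k : nat, (0 < k)%N -> eventually_shift_invariant U k ->
        (h <= k)%N].

Definition finite_rational_partition (K : fieldType) (I : Type)
    (Omega : set I) (U : I -> set nat) : Prop :=
  [/\ finite_set Omega,
      forall a, Omega a -> rational_subset K (U a) &
      exists D : set nat,
        [/\ finite_set D,
            ~` D = \bigcup_(a in Omega) (U a `\` D) &
            trivIset Omega (fun a => U a `\` D)]].

Definition partition_period (I : choiceType) (Omega : set I)
    (U : I -> set nat) (h : nat) : Prop :=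
  exists per : I -> nat,
    (forall a, Omega a -> has_period (U a) (per a)) /\
    h = \big[lcmn/1%N]_(a \in Omega) per a.

(* Accumulation points in the sense of limits of subsequences. *)
Definition accumulation_points (T : topologicalType) (X : nat -> T) : set T :=
  [set a | exists f : nat -> nat,
     {homo f : m n / (m < n)%N} /\ X (f n) @[n --> \oo] --> a].

(* X is finite rationally accumulating of period h. *)
Definition finite_rationally_accumulating (K : fieldType)
    (T : topologicalType) (X : nat -> T) (h : nat) : Prop :=
  let Omega := accumulation_points X in
  finite_set Omega /\
  exists V : T -> set T,
    let U := fun a => [set n | V a (X n)] in
    [/\ forall a, Omega a -> open (V a) /\ V a a,
        trivIset Omega V,
        finite_rational_partition K Omega U &
        partition_period Omega U h].

(* If P n = 0 this is the zero series; for tame P that happens only for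
   finitely many n. *)
Definition oppX (K : numFieldType) (P : fps K) (n : nat) : fps K :=
  fun k => if (k <= n)%N then P (n - k)%N / P n else 0.

Definition opposite_series (K : numFieldType) (P : fps K) : set (fps K) :=
  accumulation_points (oppX P).

(* n tends to infinity inside the residue class of e modulo h. *)
Definition residue_oo (h : nat) (e : int) : set_system nat :=
  within [set n : nat | (n%:Z = e %[mod h%:Z])%Z] \oo.

(* The series a^[e]; an element [e] of Z/hZ is given by any integer
   representative e. *)
Definition opp_lim (K : numFieldType) (P : fps K) (h : nat) (e : int) : fps K :=
  lim (oppX P n @[n --> residue_oo h e]).

(* The numerator A^[e]. *)
Definition opp_num (K : numFieldType) (P : fps K) (h : nat) (e : int) :
    {poly K} :=
  \sum_(j < h)
     (\prod_(1 <= i < j.+1) opp_lim P h (e - i%:Z + 1) 1%N) *: 'X^j.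

(* The constant A_P. *)
Definition opp_prod (K : numFieldType) (P : fps K) (h : nat) : K :=
  \prod_(i < h) opp_lim P h i%:Z 1%N.

(* The complex modulus with values in R; the library norm `|z| has values in
   R[i]. *)
Definition cabs (R : realType) (z : R[i]) : R := ComplexField.Normc.normc z.

(* The lower bound u > 0 forces P n != 0 for large n, since x / 0 = 0. *)
Definition tame (R : realType) (P : fps R[i]) : Prop :=
  exists u v : R, [/\ 0 < u, 0 < v &
    \forall n \near \oo, u <= cabs (P n.-1 / P n) <= v].

Definition root_coef (R : realType) (P : fps R[i]) (n : nat) : \bar R :=
  (cabs (P n) `^ n%:R^-1)%:E.

(* r_P and R_P are extended reals: the inverse on \bar R satisfies
   0^-1 = +oo and +oo^-1 = 0. *)
Definition r_radius (R : realType) (P : fps R[i]) : \bar R :=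
  ((limn_esup (root_coef P))^-1)%E.

Definition R_radius (R : realType) (P : fps R[i]) : \bar R :=
  ((limn_einf (root_coef P))^-1)%E.

(* Main.v *)
Require Import Defs.
From HB Require Import structures.
From mathcomp Require Import all_boot all_order all_algebra.
From mathcomp Require Import complex.
From mathcomp Require Import ring.
From mathcomp Require Import all_classical all_reals all_analysis.
Set Implicit Arguments.
Unset Strict Implicit.
Unset Printing Implicit Defensive.

Import Order.TTheory GRing.Theory Num.Theory.
Import numFieldNormedType.Exports.
Local Open Scope classical_set_scope.
Local Open Scope complex_scope.
Local Open Scope ring_scope.

(* For tame P the sequence X_n(P) stays in a compact set, so along each U_a, where
   a is the only possible accumulation point, it converges to a.  The U_a are
   eventually h-periodic, hence each residue class modulo h eventually lies in one
   U_a and X_n converges along it.  Passing to the limit in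
   X_(n+1)(s) = 1 + (gamma_n / gamma_(n+1)) s X_n(s) gives
   a^[e]_(k+1) = a^[e]_1 a^[e-1]_k, so a^[e]_(k+h) = A_P a^[e]_k: this is the
   rational expression.  Finally |gamma_n / gamma_(n+h)| tends to |A_P| along all n,
   and a Cesaro mean of the logarithms yields lim |gamma_n|^(1/n) = |A_P|^(-1/h). *)

(** * The real-valued modulus: convergence and compact discs *)

Section ComplexModulus.
Variable R : realType.
Implicit Types z w : R[i].

Lemma normcE z : `|z| = (cabs z)%:C.
Proof. by []. Qed.

Lemma cabs_ge0 z : 0 <= cabs z.
Proof. by have := normr_ge0 z; rewrite normcE lecR. Qed.

Lemma cabsM z w : cabs (z * w) = cabs z * cabs w.
Proof. exact: ComplexField.Normc.normcM. Qed.

Lemma cabs1 : cabs (1 : R[i]) = 1.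
Proof. exact: ComplexField.Normc.normc1. Qed.

Lemma cabs0 : cabs (0 : R[i]) = 0.
Proof. exact: ComplexField.Normc.normc0. Qed.

Lemma cabsN z : cabs (- z) = cabs z.
Proof. by apply: (@complexI R); rewrite -!normcE normrN. Qed.

Lemma cabsV z : cabs z^-1 = (cabs z)^-1.
Proof. exact: ComplexField.Normc.normcV. Qed.

Lemma cabsf_div z w : cabs (z / w) = cabs z / cabs w.
Proof. by rewrite cabsM cabsV. Qed.

Lemma cabsX z n : cabs (z ^+ n) = cabs z ^+ n.
Proof. by elim: n => [|n IH]; rewrite ?cabs1 // !exprS cabsM IH. Qed.

Lemma cabs_eq0 z : (cabs z == 0) = (z == 0).
Proof.
by rewrite -(normr_eq0 z) normcE -[0 in RHS]/(0%:C) (inj_eq (@complexI R)).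
Qed.

Lemma cabs_gt0 z : (0 < cabs z) = (z != 0).
Proof. by rewrite lt0r cabs_eq0 cabs_ge0 andbT. Qed.

Lemma ler_cabsD z w : cabs (z + w) <= cabs z + cabs w.
Proof. by rewrite -lecR rmorphD /= -!normcE ler_normD. Qed.

Lemma ler_cabsB_ReIm (x y x' y' : R) :
  cabs ((x +i* y) - (x' +i* y')) <= `|x - x'| + `|y - y'|.
Proof.
have -> : (x +i* y) - (x' +i* y') = (x - x')%:C + (0 +i* 1) * (y - y')%:C.
  by simpc.
apply: le_trans (ler_cabsD _ _) _.
by rewrite cabsM /cabs /= !expr0n /= !addr0 !add0r expr1n sqrtr1 mul1r !sqrtr_sqr.
Qed.

Lemma cvg_cabsP (T : Type) (F : set_system T) (f : T -> (R[i] : numFieldType)) l :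
  Filter F -> f @ F --> l <-> cabs (f x - l) @[x --> F] --> 0.
Proof.
move=> FF; split.
  move/cvgrPdist_lt => fl; apply/cvgrPdist_lt => e e0.
  have /fl : 0 < e%:C :> R[i] by rewrite ltcR.
  apply: filterS => x; rewrite distrC normcE ltcR sub0r normrN ger0_norm //.
  exact: cabs_ge0.
move/cvgrPdist_lt => fl; apply/cvgrPdist_lt => e e0.
(* In the order of [R[i]] a positive element is necessarily real. *)
have eE : e = (complex.Re e)%:C.
  by have /complex_realP[r ->] : e \is Num.real by exact: gtr0_real.
have /fl : 0 < complex.Re e by rewrite -ltcR -eE.
apply: filterS => x; rewrite sub0r normrN ger0_norm ?cabs_ge0 // => lte.
by rewrite distrC normcE eE ltcR.
Qed.

Lemma cvg_cabs (T : Type) (F : set_system T) (f : T -> (R[i] : numFieldType))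
    (l : (R[i] : numFieldType)) :
  Filter F -> f @ F --> l -> cabs (f x) @[x --> F] --> cabs l.
Proof.
move=> FF /cvg_cabsP/cvgrPdist_lt fl; apply/cvgrPdist_lt => e /fl.
apply: filterS => x; rewrite sub0r normrN ger0_norm ?cabs_ge0 // => lte.
apply: le_lt_trans lte; rewrite ler_norml lerNl opprB !lerBlDr.
have := ler_cabsD (f x - l) l; rewrite subrK => -> /=.
have := ler_cabsD (l - f x) (f x); rewrite subrK.
by rewrite -opprB cabsN.
Qed.

(** The disc lies in a square, the continuous image of a product of two segments. *)
Lemma compact_cabs_le (M : R) :
  exists C : set (R[i] : numFieldType),
    compact C /\ [set z | cabs z <= M] `<=` C.
Proof.
pose g (u : R * R) : (R[i] : numFieldType) := u.1 +i* u.2.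
exists (g @` (`[- M, M] `*` `[- M, M])); split; last first.
  move=> [x y] /= xyM; exists (x, y) => //=.
  have [x2 y2] : `|x| <= M /\ `|y| <= M.
    split; apply: le_trans xyM; rewrite /cabs /= -sqrtr_sqr ler_wsqrtr //.
      by rewrite lerDl sqr_ge0.
    by rewrite lerDr sqr_ge0.
  by rewrite !in_itv /= -!ler_norml.
apply: continuous_compact; last by apply: compact_setX; exact: segment_compact.
apply: continuous_subspaceT => -[x y].
apply/cvg_cabsP; apply: (@squeeze_cvgr _ _ _ _ (fun=> 0)
    (fun u : R * R => `|u.1 - x| + `|u.2 - y|)).
- by near=> u; rewrite cabs_ge0; exact: ler_cabsB_ReIm.
- exact: cvg_cst.
- rewrite -(addr0 0) -{1}(normr0 R) -{2}(normr0 R); apply: cvgD; apply: cvg_norm.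
    by rewrite -(subrr x); apply: cvgB; [exact: cvg_fst|exact: cvg_cst].
  by rewrite -(subrr y); apply: cvgB; [exact: cvg_snd|exact: cvg_cst].
Unshelve. all: by end_near. Qed.

End ComplexModulus.

(** * Subsequential limits and compactness for sequences of power series *)

Section Accumulation.
Variable R : realType.
Local Notation C := (R[i] : numFieldType).
Implicit Types (X : nat -> fps R[i]) (a b : fps R[i]).

Lemma fps_cvgP (T : Type) (F : set_system T) (X : T -> fps R[i]) a :
  Filter F ->
  X @ F --> a <-> forall k, (fun n => X n k : C) @ F --> (a k : C).
Proof.
move=> FF; split => Xa.
  exact/(@pointwise_cvgP nat C (X @ F)).
exact/(@pointwise_cvgP nat C (X @ F)).
Qed.


Lemma fps_nbhs_cabs_lt b (m : nat) (e : R) : 0 < e ->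
  nbhs b [set x : fps R[i] | forall k, (k < m)%N -> cabs (x k - b k) < e].
Proof.
move=> e0; elim: m => [|m IH]; first by apply: filterS filterT.
have /cvg_cabsP/cvgrPdist_lt/(_ e e0) H :
    (fun x : fps R[i] => x m : C) @ nbhs b --> (b m : C).
  by move: m {IH}; apply/(fps_cvgP _ _ _); exact: cvg_id.
apply: filterS (filterI IH H) => x [xlt xm] k.
rewrite ltnS leq_eqVlt => /predU1P[->|]; last exact: xlt.
by move: xm; rewrite sub0r normrN ger0_norm ?cabs_ge0.
Qed.

(** A diagonal choice: the m-th index makes the first m + 1 coefficients lie within 1/(m + 1) of
    those of [b]. *)
Lemma cluster_subsequence X (A : set nat) b :
  cluster (X @ within A \oo) b ->
  exists f : nat -> nat, [/\ {homo f : m n / (m < n)%N},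
    forall m, A (f m) & X (f n) @[n --> \oo] --> b].
Proof.
move=> Xb.
have next N m : {n | (N <= n)%N /\ A n /\
    forall k, (k < m.+1)%N -> cabs (X n k - b k) < m.+1%:R^-1}.
  apply: cid.
  have [||x [[n [An Nn] <-] xb]] := Xb (X @` (A `&` [set n | (N <= n)%N]))
      [set x | forall k, (k < m.+1)%N -> cabs (x k - b k) < m.+1%:R^-1].
  - by exists N => // n /= Nn An; exists n.
  - by apply: fps_nbhs_cabs_lt; rewrite invr_gt0.
  by exists n.
(* Each search starts above the previous index, so [f] is strictly increasing. *)
pose f := fix f m :=
  if m is m'.+1 then sval (next (f m').+1 m) else sval (next 0%N 0%N).
have fP m : A (f m) /\
    forall k, (k < m.+1)%N -> cabs (X (f m) k - b k) < m.+1%:R^-1.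
  by case: m => [|m]; rewrite /=; case: (next _ _) => n [].
exists f; split.
- apply: homo_ltn => [m n p|m]; first exact: ltn_trans.
  by rewrite /=; case: (next _ _) => n [].
- by move=> m; have [] := fP m.
- apply/fps_cvgP => k; apply/cvg_cabsP.
  apply: (@squeeze_cvgr _ _ _ _ (fun=> 0) (@harmonic R)).
  + near=> m; rewrite cabs_ge0 ltW //; have [_] := fP m; apply.
    by rewrite ltnS; near: m; exact: nbhs_infty_ge.
  + exact: cvg_cst.
  + exact: cvg_harmonic.
Unshelve. all: by end_near. Qed.

(** Otherwise infinitely many indices of [A] send [X] outside some neighbourhood [W] of [a]; by
    compactness a subsequence of these converges, necessarily to [a], while avoiding [W]. *)
Lemma cvg_within_unique_accumulation X (A : set nat) (K : set (fps R[i])) a :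
  compact K -> (forall n, K (X n)) ->
  (forall f b, {homo f : m n / (m < n)%N} -> (forall m, A (f m)) ->
    X (f n) @[n --> \oo] --> b -> b = a) ->
  X @ within A \oo --> a.
Proof.
move=> cK KX ua W Wa; apply: contrapT => nW.
pose B := A `&` [set n | ~ W (X n)].
have PB : ProperFilter (within B \oo).
  apply: Build_ProperFilter_ex => S SB; apply: contrapT => nS; apply: nW.
  case: SB => N _ NS; exists N => // n /NS Sn /= An; apply: contrapT => nWn.
  by apply: nS; exists n; exact: Sn.
have [|b [_ bX]] := cK (X @ within B \oo) _.
  by exists 0%N => // n _ _; exact: KX.
have [f [fincr fB fb]] := cluster_subsequence bX.
have ba : b = a by apply: ua fincr _ fb => m; have [] := fB m.
have [N _ /(_ N (leqnn N)) /=] : \forall n \near \oo, W (X (f n)).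
  by apply: fb; rewrite ba.
by have [] := fB N.
Unshelve. all: by end_near. Qed.

Lemma bounded_coef_compact X :
  (forall k, exists M, forall n, cabs (X n k) <= M) ->
  exists K : set (fps R[i]), compact K /\ forall n, K (X n).
Proof.
move=> /choice[M XM]; have /choice[K KP] := fun k => compact_cabs_le (M k).
exists [set f | forall k, K k (f k)]; split.
  by apply: (@tychonoff nat (fun=> C) K) => k; have [] := KP k.
by move=> n k; have [_] := KP k; apply; exact: XM.
Qed.

Lemma bounded_eventually (u : nat -> R) (M : R) :
  (\forall n \near \oo, u n <= M) -> exists M', forall n, u n <= M'.
Proof.
case=> N _ uM; exists (Num.max M (\big[Num.max/M]_(i < N) u i)) => n.
rewrite le_max; have [nN|Nn] := ltnP n N.
  apply/orP; right; exact: (le_bigmax _ _ (Ordinal nN)).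
by rewrite uM.
Qed.

End Accumulation.

(** * Residue classes and convergence along them *)

Lemma residue_class_unbounded (h : nat) (e : int) (N : nat) : (0 < h)%N ->
  exists n : nat, (N <= n)%N /\ (n%:Z = e %[mod h%:Z])%Z.
Proof.
move=> h0; exists (`|(e %% h)%Z| + N * h)%N; split.
  by rewrite (leq_trans (leq_pmulr _ h0)) // leq_addl.
rewrite PoszD PoszM addrC modzMDl gez0_abs ?modz_ge0 ?modz_mod //.
by rewrite eqz_nat -lt0n.
Qed.

Lemma residue_proper (h : nat) (e : int) : (0 < h)%N ->
  ProperFilter (residue_oo h e).
Proof.
move=> h0; apply: Build_ProperFilter_ex => S [N _ NS].
have [n [Nn ne]] := residue_class_unbounded e N h0.
by exists n; exact: NS.
Qed.

(** Passes from the period of one part to the period of the whole partition, which is a multiple of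
    it. *)
Lemma eventually_shift_invariantM (U : set nat) k j :
  eventually_shift_invariant U k -> eventually_shift_invariant U (j * k).
Proof.
move=> [N _ NU]; exists N => // n /= Nn; elim: j => [|j IH].
  by rewrite mul0n addn0.
rewrite mulSn addnCA -IH addnC; apply: NU => /=.
by rewrite (leq_trans Nn) // leq_addr.
Qed.

Lemma filter_finite_forall (T : Type) (F : set_system T) (I : choiceType)
    (A : set I) (S : I -> set T) : Filter F -> finite_set A ->
  (forall a, A a -> F (S a)) -> F [set x | forall a, A a -> S a x].
Proof.
move=> FF /finite_seqP[s ->]; elim: s => [|a s IH] FS.
  by apply: filterS filterT => x _ a.
have /(filterI (FS a (mem_head _ _))) : F [set x | forall a, [set` s] a -> S a x].
  by apply: IH => b sb; apply: FS; rewrite /= inE sb orbT.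
by apply: filterS => x [Sa Ss] b; rewrite /= inE => /predU1P[->//|/Ss].
Qed.

Lemma dvdn_fsbig_lcmn (I : choiceType) (A : set I) (F : I -> nat) a :
  finite_set A -> A a -> (F a %| \big[lcmn/1%N]_(i \in A) F i)%N.
Proof. by move=> fA Aa; rewrite (fsbigD1 a) //= dvdn_lcml. Qed.

(** The parts are eventually [h]-periodic, so a residue class eventually stays in the part of a
    single [a], and along that part [a] is the only possible subsequential limit. *)
Lemma finite_rationally_accumulating_cvg (R : realType) (X : nat -> fps R[i])
    (K : set (fps R[i])) (h : nat) (e : int) :
  compact K -> (forall n, K (X n)) -> (0 < h)%N ->
  finite_rationally_accumulating R[i] X h ->
  exists2 a, accumulation_points X a & X @ residue_oo h e --> a.
Proof.
move=> cK KX h0 [finO [V [Vnbhs Vdisj [_ _ [D [finD cover _]]] [per [perP hE]]]]].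
have shiftU a : accumulation_points X a ->
    eventually_shift_invariant [set n | V a (X n)] h.
  move=> Oa; have [_ Ua _] := perP a Oa.
  have /dvdnP[j ->] : (per a %| h)%N by rewrite hE; exact: dvdn_fsbig_lcmn.
  exact: eventually_shift_invariantM.
(* [N] lies past the finite exceptional set [D] and past the thresholds of all the finitely many [a]
   at once. *)
have [N _ NP] : \forall n \near \oo, ~ D n /\ forall a, accumulation_points X a ->
    V a (X (n + h)%N) <-> V a (X n).
  apply: filterI.
    have [M DM] : exists M, forall n, D n -> (n <= M)%N.
      have /finite_seqP[s ->] := finD.
      exists (\max_(i <- s) i)%N => n /= ns.
      by rewrite (big_rem n) //= leq_maxl.
    by exists M.+1 => // n /= Mn /DM; rewrite leqNgt Mn.
  exact: filter_finite_forall.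
have [n0 [Nn0 n0e]] := residue_class_unbounded e N h0.
have [a Oa [Va _]] : (\bigcup_(a in accumulation_points X)
    ([set n | V a (X n)] `\` D)) n0.
  by rewrite -cover; have [] := NP n0 Nn0.
exists a => //.
have VaX n : (n0 <= n)%N -> (n%:Z = e %[mod h%:Z])%Z -> V a (X n).
  move=> n0n ne.
  have /dvdnP[j jE] : (h %| n - n0)%N.
    have : (h%:Z %| n%:Z - n0%:Z)%Z by rewrite -eqz_mod_dvd ne n0e.
    by rewrite subzn.
  rewrite -(subnKC n0n) jE; elim: j {jE} => [|j IH]; first by rewrite mul0n addn0.
  rewrite mulSn addnCA addnC.
  have [|_ /(_ a Oa) ->//] := NP (n0 + j * h)%N.
  exact: leq_trans (leq_addr _ _).
(* A subsequence inside [V a] with limit [b] also enters [V b]; disjointness then gives [b = a]. *)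
have : X @ within [set n | V a (X n)] \oo --> a.
  apply: cvg_within_unique_accumulation cK KX _ => f b fincr fV fb.
  have Ob : accumulation_points X b by exists f.
  apply: Vdisj => //; have [oVb Vbb] := Vnbhs b Ob.
  have [M _ /(_ M (leqnn M)) VbM] : \forall n \near \oo, V b (X (f n)).
    by apply: fb; exact: open_nbhs_nbhs.
  by exists (X (f M)); split => //; exact: fV.
move=> Xa W /Xa [M _ MW]; exists (maxn n0 M) => // n.
rewrite /= geq_max => /andP[n0n Mn] ne; apply: MW => //=; exact: VaX.
Qed.

(** * Rationality and convergence of series that are periodic up to a factor *)

Section TwistedPeriodicSeries.
Variables (K : numFieldType) (h : nat) (A : K) (f : nat -> K).
Hypothesis h_gt0 : (0 < h)%N.
Hypothesis fh : forall k, f (k + h)%N = A * f k.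
Let q : {poly K} := 1 - A *: 'X^h.

(** The k-th coefficient of the product is [f k] for k < h, and f k - A f (k - h) = 0 from then
    on. *)
Lemma fps_quotient_periodic : fps_quotient f (\poly_(j < h) f j) q.
Proof.
have qE i : q`_i = (i == 0%N)%:R - A * (i == h)%:R.
  by rewrite coefB coef1 coefZ coefXn.
split.
  apply/eqP => /(congr1 (fun r : {poly K} => r`_0)) /eqP.
  by rewrite qE coef0 eqxx (ltn_eqF h_gt0) mulr0 subr0 oner_eq0.
move=> k; rewrite coef_poly.
under eq_bigr do rewrite qE mulrBl.
rewrite sumrB (bigD1 ord0) //= mul1r subn0 big1 ?addr0; last first.
  by move=> i /negPf; rewrite -val_eqE /= => ->; rewrite mul0r.
have [kh|hk] := ltnP k h.
  rewrite big1 ?subr0 // => i _; rewrite (ltn_eqF (leq_trans (ltn_ord i) kh)).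
  by rewrite mulr0 mul0r.
rewrite (bigD1 (Ordinal (hk : h < k.+1)%N)) //= eqxx mulr1 big1 ?addr0; last first.
  by move=> i /negPf; rewrite -val_eqE /= => ->; rewrite mulr0 mul0r.
by rewrite -fh subnK // subrr.
Qed.

Lemma series_periodic (s : K) n :
  series (fun k => f k * s ^+ k) (n + h)%N =
  (\poly_(j < h) f j).[s] + A * s ^+ h * series (fun k => f k * s ^+ k) n.
Proof.
rewrite /series /= addnC (@big_cat_nat _ _ _ h) //= ?leq_addr //; congr (_ + _).
  by rewrite horner_poly big_mkord.
rewrite -{1}(add0n h) big_addn addnC addnK mulr_sumr; apply: eq_bigr => i _.
by rewrite fh exprD; ring.
Qed.

End TwistedPeriodicSeries.

Lemma cvg_divn_infty (h : nat) : (0 < h)%N -> (n %/ h)%N @[n --> \oo] --> \oo.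
Proof.
move=> h0 S [N _ NS]; exists (N * h)%N => // n /= Nn; apply: NS => /=.
by rewrite leq_divRL.
Qed.

(** With z = A s^h and [L] the proposed sum, S (n + h) - L = z (S n - L), so the error decays
    geometrically once |z| < 1. *)
Lemma fps_converges_to_periodic (R : realType) (h : nat) (A : R[i]) (f : fps R[i]) :
  (0 < h)%N -> (forall k, f (k + h)%N = A * f k) ->
  fps_converges_to f (\poly_(j < h) f j) (1 - A *: 'X^h).
Proof.
move=> h0 fh; rewrite /fps_converges_to.
have : (fun s : (R[i] : numFieldType) => s) @ nbhs 0 --> (0 : (R[i] : numFieldType)).
  exact: cvg_id.
have A1 : 0 < 1 + cabs A by rewrite ltr_pwDl // cabs_ge0.
(* This radius ensures |s| <= 1 and |A| |s| < 1, hence |A s^h| < 1 without extracting an h-th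
   root. *)
have d0 : 0 < (1 + cabs A)^-1 by rewrite invr_gt0.
move=> /cvg_cabsP/cvgrPdist_lt/(_ _ d0).
apply: filterS => s; rewrite sub0r normrN ger0_norm ?cabs_ge0 // subr0 => sd.
set S := series _; set p := (\poly_(j < h) f j).[s].
pose z := A * s ^+ h.
have z1 : cabs z < 1.
  have s1 : cabs s <= 1.
    rewrite (le_trans (ltW sd)) // invf_le1 // lerDl cabs_ge0 //.
  rewrite cabsM cabsX; apply: (@le_lt_trans _ _ (cabs A * cabs s)).
    by rewrite ler_wpM2l ?cabs_ge0 // -[leRHS]expr1 ler_wiXn2l // cabs_ge0.
  apply: (@le_lt_trans _ _ (cabs A / (1 + cabs A))).
    by rewrite ler_wpM2l ?cabs_ge0 // ltW.
  by rewrite ltr_pdivrMr // mul1r ltrDr.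
have qs : (1 - A *: 'X^h).[s] = 1 - z by rewrite !hornerE.
have q0 : 1 - z != 0.
  by rewrite subr_eq0; apply: contraTneq z1 => <-; rewrite cabs1 ltxx.
rewrite qs; set L := p / _.
have SL n : S (n + h)%N - L = z * (S n - L).
  rewrite /S (series_periodic fh) -/S -/p -/z.
  have -> : p = (1 - z) * L by rewrite /L mulrCA divff ?mulr1.
  ring.
have SLm j r : S (j * h + r)%N - L = z ^+ j * (S r - L).
  elim: j => [|j IH]; first by rewrite mul0n add0n mul1r.
  by rewrite mulSn -addnA addnC SL IH exprS mulrA.
(* Bounds the initial error for all remainders r < h at once. *)
pose M := \sum_(r < h) cabs (S r - L).
apply/cvg_cabsP; apply: (@squeeze_cvgr _ _ _ _ (fun=> 0)
    (fun n => cabs z ^+ (n %/ h)%N * M)).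
- near=> n; rewrite cabs_ge0 /= {1}(divn_eq n h) SLm cabsM cabsX.
  rewrite ler_wpM2l ?exprn_ge0 ?cabs_ge0 //.
  rewrite /M (bigD1 (Ordinal (ltn_pmod n h0))) //= lerDl sumr_ge0 // => i _.
  exact: cabs_ge0.
- exact: cvg_cst.
- rewrite -(mul0r M); apply: cvgM; last exact: cvg_cst.
  apply: (@cvg_comp _ _ _ (fun n => n %/ h)%N (fun j => cabs z ^+ j) _ \oo).
    exact: cvg_divn_infty.
  by apply: cvg_expr; rewrite ger0_norm // cabs_ge0.
Unshelve. all: by end_near. Qed.

(** * Products over a full period and a Cesaro argument *)

Lemma prod_periodic (K : comPzRingType) (c : int -> K) (h : nat) (e : int) :
  (forall e, c (e + h%:Z) = c e) ->
  \prod_(1 <= i < h.+1) c (e - i%:Z + 1) = \prod_(i < h) c i%:Z.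
Proof.
case: h => [|h] ch; first by rewrite big_nil big_ord0.
pose G e := \prod_(i < h.+1) c (e - i%:Z).
have GE x : \prod_(1 <= i < h.+2) c (x - i%:Z + 1) = G x.
  rewrite big_add1 big_mkord; apply: eq_bigr => i _; congr c.
  by rewrite -addn1 PoszD; ring.
(* The shift trades the factor [c (x - h)] for [c (x + 1)]; they agree because the period is now
   [h.+1]. *)
have GS x : G (x + 1) = G x.
  rewrite /G big_ord_recl big_ord_recr /= mulrC; congr (_ * _).
    by apply: eq_bigr => i _; rewrite /bump /= add1n -addn1 PoszD; congr c; ring.
  by rewrite -[RHS]ch; congr c; rewrite -addn1 PoszD; ring.
have G0 x : G x = G 0.
  elim/int_ind: x => // n IH; first by rewrite -addn1 PoszD GS.
  by rewrite -[LHS]GS -addn1 PoszD -IH; congr G; ring.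
rewrite GE G0 -(G0 h%:Z) /G (reindex_inj rev_ord_inj) /=; apply: eq_bigr => i _.
by congr c; rewrite subSS -subzn ?leq_ord //; ring.
Qed.

(* The partial sums of l (n + h) - l n telescope to h * l n up to a bounded error. *)
Lemma cvg_div_increment (R : realType) (l : nat -> R) (h : nat) (c B : R) :
  (0 < h)%N -> l (n + h)%N - l n @[n --> \oo] --> c ->
  (\forall n \near \oo, `|l n.+1 - l n| <= B) ->
  n%:R^-1 * l n @[n --> \oo] --> c / h%:R.
Proof.
move=> h0 lc [N _ NB].
pose b n := l (n + h)%N - l n.
have hR0 : (h%:R : R) != 0 by rewrite pnatr_eq0 -lt0n.
(* The number of terms no longer depends on [n], and each l (n + j) stays within a bounded distance
   of l n. *)
have serE n : series b n = \sum_(j < h) (l (n + j)%N - l j).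
  elim: n => [|n IH].
    by rewrite /series /= big_geq // big1 // => i _; rewrite subrr.
  rewrite seriesSr /= IH /b; apply/eqP; rewrite eq_sym addrC -subr_eq -sumrB.
  under eq_bigr do rewrite opprB addrA subrK addSnnS.
  rewrite -(big_mkord xpredT (fun j => l (n + j.+1)%N - l (n + j)%N)).
  by rewrite telescope_sumr // addn0.
have incr n j : (N <= n)%N -> `|l (n + j)%N - l n| <= j%:R * B.
  move=> Nn; elim: j => [|j IH]; first by rewrite addn0 subrr normr0 mul0r.
  have -> : l (n + j.+1)%N - l n =
      (l (n + j).+1 - l (n + j)%N) + (l (n + j)%N - l n).
    by rewrite addnS; ring.
  rewrite (le_trans (ler_normD _ _)) // -natr1 mulrDl mul1r addrC lerD //.
  by apply: NB; rewrite /= (leq_trans Nn) // leq_addr.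
pose M := \sum_(j < h) (j%:R * B + `|l j|).
have bound n : (N <= n)%N -> `|series b n - h%:R * l n| <= M.
  move=> Nn; rewrite serE.
  have -> : h%:R * l n = \sum_(j < h) l n by rewrite sumr_const card_ord mulr_natl.
  rewrite -sumrB (le_trans (ler_norm_sum _ _ _)) //; apply: ler_sum => j _.
  by rewrite addrAC (le_trans (ler_normB _ _)) // lerD // incr.
(* The shift matches [arithmetic_mean b n], which averages the first n + 1 terms. *)
rewrite -cvg_shiftS.
have -> : (fun n => n.+1%:R^-1 * l n.+1) = (fun n => h%:R^-1 *
    (arithmetic_mean b n - n.+1%:R^-1 * (series b n.+1 - h%:R * l n.+1))).
  by apply/funext => n; rewrite /arithmetic_mean /= -mulrBr subKr mulrCA mulKf.
rewrite mulrC; apply: cvgM; first exact: cvg_cst.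
rewrite -[X in _ --> X]subr0; apply: cvgB; first exact: cesaro.
apply/norm_cvg0P; apply: (@squeeze_cvgr _ _ _ _ (fun=> 0)
    (fun n => harmonic n * M)).
- near=> n; rewrite normr_ge0 /= normrM ger0_norm ?invr_ge0 // ler_wpM2l ?invr_ge0 //.
  by apply: bound; rewrite leqW //; near: n; exact: nbhs_infty_ge.
- exact: cvg_cst.
- by rewrite -(mul0r M); apply: cvgM; [exact: cvg_harmonic|exact: cvg_cst].
Unshelve. all: by end_near. Qed.

(** * Changing and combining residue classes in limits *)

Lemma residue_oo_eqmod (h : nat) (e e' : int) :
  (e = e' %[mod h%:Z])%Z -> residue_oo h e = residue_oo h e'.
Proof. by move=> ee'; rewrite /residue_oo ee'. Qed.

Lemma cvg_residues (T : topologicalType) (f : nat -> T) (h : nat) (l : T) :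
  (0 < h)%N -> (forall e : int, f @ residue_oo h e --> l) -> f @ \oo --> l.
Proof.
move=> h0 fl W Wl.
have : \oo [set n | forall e, `I_h e -> (n%:Z = e%:Z %[mod h%:Z])%Z -> W (f n)].
  by apply: filter_finite_forall => [|e _]; [exact: finite_II|exact: fl].
apply: filterS => n; apply; first exact: (ltn_pmod n h0).
by rewrite -modz_nat modz_mod.
Qed.

Lemma cvg_pred_residue (h : nat) (e : int) :
  n.-1 @[n --> residue_oo h e] --> residue_oo h (e - 1).
Proof.
move=> S [N _ NS]; exists N.+1 => // -[//|n] /= Nn ne; apply: NS => //=.
have -> : n%:Z = n.+1%:Z - 1 by rewrite -addn1 PoszD addrK.
by rewrite -(modzDml n.+1) ne modzDml.
Qed.

(** * Tame series: the recursion for X_n and its compactness *)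

Section TameSeries.
Variables (R : realType) (P : fps R[i]).
Local Notation C := (R[i] : numFieldType).

Lemma oppX0 n : P n != 0 -> oppX P n 0%N = 1.
Proof. by move=> Pn; rewrite /oppX subn0 divff. Qed.

(** [P n] cancels in the product, and both sides are truncated at the same [k]. *)
Lemma oppXS n k : P n != 0 -> oppX P n.+1 k.+1 = oppX P n.+1 1%N * oppX P n k.
Proof.
move=> Pn; rewrite /oppX !ltnS subSS subn1 leq0n /=.
by case: leqP => _; rewrite ?mulr0 // mulrAC mulrCA divff // mulr1.
Qed.

Lemma tame_bounds : tame P -> exists (u v : R) (N : nat), [/\ 0 < u, 0 < v,
  forall n, (N <= n)%N -> P n != 0 &
  forall n, (N <= n)%N -> u <= cabs (oppX P n.+1 1%N) <= v].
Proof.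
move=> [u [v [u0 v0 [N _ uv]]]]; exists u, v, N; split=> // n Nn.
  apply: contraTneq (uv n Nn) => -> /=.
  by rewrite invr0 mulr0 cabs0 lt_geF.
by rewrite /oppX subn1; exact: uv n.+1 (leqW Nn).
Qed.

(** The recursion bounds the k-th coefficient by v^k once n >= N + k; the finitely many earlier
    terms only enlarge the bound. *)
Lemma tame_compact : tame P ->
  exists K : set (fps R[i]), compact K /\ forall n, K (oppX P n).
Proof.
move=> /tame_bounds[u [v [N [_ v0 P0 uv]]]].
apply: bounded_coef_compact => k; apply: (@bounded_eventually _ _ (v ^+ k)).
exists (N + k)%N => // n /=; elim: k n => [|k IH] n.
  by rewrite addn0 => Nn; rewrite oppX0 ?cabs1 ?P0.
case: n => [|n]; first by rewrite addnS.
rewrite addnS ltnS => Nkn.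
have Nn : (N <= n)%N by apply: leq_trans Nkn; exact: leq_addr.
rewrite oppXS ?P0 // cabsM exprS ler_pM ?cabs_ge0 ?IH //.
by have /andP[] := uv n Nn.
Qed.

End TameSeries.

(** * Coefficients of the opposite series and growth of the original one *)

Section OppositeSeries.
Variables (R : realType) (P : fps R[i]) (h : nat).
Hypotheses (tameP : tame P) (h_gt0 : (0 < h)%N).
Hypothesis accP : finite_rationally_accumulating R[i] (oppX P) h.
Local Notation C := (R[i] : numFieldType).
Local Notation a := (opp_lim P h).

Let residue_filter e : ProperFilter (residue_oo h e).
Proof. exact: residue_proper. Qed.

#[local] Existing Instance residue_filter.

(** Compactness provides a limit along the class; the Hausdorff property identifies it with the
    [lim] defining [opp_lim]. *)
Lemma opp_lim_cvg_accumulation e :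
  oppX P n @[n --> residue_oo h e] --> a e /\ opposite_series P (a e).
Proof.
have [K [cK KX]] := tame_compact tameP.
have [b Ob Xb] := finite_rationally_accumulating_cvg e cK KX h_gt0 accP.
suff -> : a e = b by [].
apply: cvg_lim Xb.
by apply: hausdorff_product => _; exact: norm_hausdorff.
Qed.

Lemma opp_lim_coef_cvg e k :
  (fun n => oppX P n k : C) @ residue_oo h e --> (a e k : C).
Proof. by move: k; apply/fps_cvgP; have [] := opp_lim_cvg_accumulation e. Qed.

Lemma opp_limDh e : a (e + h%:Z) = a e.
Proof.
rewrite /opp_lim (@residue_oo_eqmod h _ e) //.
by rewrite -{1}[h%:Z]mul1r addrC modzMDl.
Qed.

Lemma near_residue e (N : nat) : \forall n \near residue_oo h e, (N <= n)%N.
Proof. by apply: cvg_within; exact: nbhs_infty_ge. Qed.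

Lemma opp_lim_coef0 e : a e 0%N = 1.
Proof.
have [u [v [N [_ _ P0 _]]]] := tame_bounds tameP.
rewrite -(cvg_lim (@norm_hausdorff _ C) (@opp_lim_coef_cvg e 0%N)).
apply: (lim_near_cst (@norm_hausdorff _ C)).
by apply: filterS (@near_residue e N) => n Nn; rewrite oppX0 ?P0.
Qed.

(** The limit of [oppXS] along the class of [e], where n - 1 runs through the class of e - 1. *)
Lemma opp_lim_coefS e k : a e k.+1 = a e 1%N * a (e - 1) k.
Proof.
have [u [v [N [_ _ P0 _]]]] := tame_bounds tameP.
have Xe1 : (fun n => oppX P n.-1 k : C) @ residue_oo h e --> (a (e - 1) k : C).
  apply: (@cvg_comp _ _ _ _ (fun n => oppX P n k : C)).
    exact: cvg_pred_residue.
  exact: opp_lim_coef_cvg.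
have XM := cvgM (@opp_lim_coef_cvg e 1%N) Xe1.
rewrite -(cvg_lim (@norm_hausdorff _ C) (XM _)).
apply/esym; apply: (cvg_lim (@norm_hausdorff _ C)).
apply: cvg_trans (@opp_lim_coef_cvg e k.+1).
apply: near_eq_cvg; apply: filterS (@near_residue e N.+1) => -[//|n] Nn.
by rewrite oppXS ?P0.
Qed.

(** Ratios of modulus at least [u] > 0 cannot tend to 0. *)
Lemma opp_lim_coef1_neq0 e : a e 1%N != 0.
Proof.
have [u [v [N [u0 _ _ uv]]]] := tame_bounds tameP.
apply/eqP => a0; have := @opp_lim_coef_cvg e 1%N.
rewrite a0 => /cvg_cabsP/cvgrPdist_lt/(_ u u0) H.
have [[|n] [] //] := filter_ex (filterI H (@near_residue e N.+1)).
rewrite sub0r normrN subr0 ger0_norm ?cabs_ge0 // => ltu /= Nn.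
by have := uv n Nn; rewrite leNgt ltu.
Qed.

Lemma opp_lim_coefD e k m : a e (k + m)%N = a e k * a (e - k%:Z) m.
Proof.
elim: k e => [|k IH] e; first by rewrite add0n opp_lim_coef0 mul1r subr0.
rewrite addSn opp_lim_coefS IH (opp_lim_coefS e k) mulrA; congr (_ * a _ _).
by rewrite -[in RHS]addn1 PoszD; ring.
Qed.

Lemma opp_lim_coefE e k : a e k = \prod_(1 <= i < k.+1) a (e - i%:Z + 1) 1%N.
Proof.
elim: k => [|k IH]; first by rewrite opp_lim_coef0 big_nil.
rewrite big_nat_recr //= -IH -addn1 opp_lim_coefD; congr (_ * a _ _).
by rewrite addn1 -addn1 PoszD; ring.
Qed.

Lemma opp_lim_coef_neq0 e k : a e k != 0.
Proof.
rewrite opp_lim_coefE prodf_seq_neq0; apply/allP => i _.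
exact: opp_lim_coef1_neq0.
Qed.

(** The product formula with [h] factors visits every residue class once, whatever the starting
    class. *)
Lemma opp_lim_coefh e : a e h = opp_prod P h.
Proof.
rewrite opp_lim_coefE (prod_periodic (c := fun e => a e 1%N)) // => e'.
by rewrite opp_limDh.
Qed.

Lemma opp_lim_coefDh e k : a e (k + h)%N = opp_prod P h * a e k.
Proof. by rewrite opp_lim_coefD opp_lim_coefh mulrC. Qed.

Lemma opp_numE e : opp_num P h e = \poly_(j < h) a e j.
Proof.
by rewrite poly_def; apply: eq_bigr => j _; rewrite opp_lim_coefE.
Qed.

Lemma size_opp_num e : size (opp_num P h e) = h.
Proof. by rewrite opp_numE size_poly_eq // opp_lim_coef_neq0. Qed.

Let alpha := cabs (opp_prod P h).

Let alpha_gt0 : 0 < alpha.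
Proof. by rewrite cabs_gt0 -(opp_lim_coefh 0) opp_lim_coef_neq0. Qed.

Lemma cvg_root_coef : root_coef P @ \oo --> (expR (- ln alpha / h%:R))%:E.
Proof.
have [u [v [N [u0 v0 P0 uv]]]] := tame_bounds tameP.
have g0 n : (N <= n)%N -> 0 < cabs (P n) by move=> /P0; rewrite cabs_gt0.
pose l n := ln (cabs (P n)).
have lh : l (n + h)%N - l n @[n --> \oo] --> - ln alpha.
  (* This modulus is eventually |P n| / |P (n + h)|; all classes share the limit because their h-th
     coefficients coincide. *)
  have ratio : cabs (oppX P (n + h)%N h) @[n --> \oo] --> alpha.
    rewrite (cvg_shiftn h (fun n => cabs (oppX P n h))).
    apply: cvg_cabs; apply: (@cvg_residues _ _ h) => // e.
    by rewrite -(opp_lim_coefh e); exact: opp_lim_coef_cvg.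
  rewrite -lnV ?posrE //.
  have : ln (cabs (oppX P (n + h)%N h))^-1 @[n --> \oo] --> ln alpha^-1.
    apply: continuous_cvg; first by apply: continuous_ln; rewrite invr_gt0.
    by apply: cvgV ratio; rewrite gt_eqF.
  apply: cvg_trans; apply: near_eq_cvg; near=> n.
  have Nn : (N <= n)%N by near: n; exact: nbhs_infty_ge.
  have Nnh : (N <= n + h)%N by rewrite (leq_trans Nn) // leq_addr.
  rewrite /oppX leq_addl addnK cabsf_div invf_div ln_div ?posrE ?g0 //.
(* Tameness places the logarithm of each consecutive ratio between ln u and ln v. *)
have linc : \forall n \near \oo, `|l n.+1 - l n| <= Num.max `|ln u| `|ln v|.
  near=> n; have Nn : (N <= n)%N by near: n; exact: nbhs_infty_ge.
  have /andP[ul lv] := uv n Nn.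
  move: ul lv; rewrite /oppX /= subn1 cabsf_div /= => ul lv.
  have r0 : 0 < cabs (P n) / cabs (P n.+1) by rewrite divr_gt0 // g0 // leqW.
  rewrite distrC -ln_div ?posrE ?g0 ?leqW //.
  rewrite le_max; set r := _ / _ in ul lv r0 *.
  have lul : ln u <= ln r by rewrite ler_ln.
  have lvl : ln r <= ln v by rewrite ler_ln.
  have [r1|r1] := ler0P (ln r); apply/orP; [left|right].
    by rewrite -normrN (le_trans _ (ler_norm _)) // lerN2.
  by rewrite (le_trans lvl) // ler_norm.
have := cvg_div_increment h_gt0 lh linc.
move=> lim_l; apply: cvg_EFin; first by near=> n.
have : expR (n%:R^-1 * l n) @[n --> \oo] --> expR (- ln alpha / h%:R).
  by apply: continuous_cvg lim_l; exact: continuous_expR.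
apply: cvg_trans; apply: near_eq_cvg; near=> n.
have Nn : (N <= n)%N by near: n; exact: nbhs_infty_ge.
by rewrite /root_coef /= /powR gt_eqF // g0.
Unshelve. all: by end_near. Qed.

End OppositeSeries.

Theorem mainTheorem4 (R : realType) (P : fps R[i]) (h : nat)
    (tameP : tame P) (h_gt0 : (0 < h)%N)
    (accP : finite_rationally_accumulating R[i] (oppX P) h) :
  (forall e : int,
     [/\ oppX P n @[n --> residue_oo h e] --> opp_lim P h e,
         opposite_series P (opp_lim P h e),
         fps_quotient (opp_lim P h e) (opp_num P h e)
           (1 - opp_prod P h *: 'X^h),
         fps_converges_to (opp_lim P h e) (opp_num P h e)
           (1 - opp_prod P h *: 'X^h) &
         size (opp_num P h e) = h]) /\
  (forall e : int, opp_lim P h e h = opp_prod P h) /\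
  (r_radius P ^+ h)%E = (cabs (opp_prod P h))%:E /\
  (R_radius P ^+ h)%E = (cabs (opp_prod P h))%:E.
Proof.
have alpha0 : 0 < cabs (opp_prod P h).
  by rewrite cabs_gt0 -(opp_lim_coefh tameP h_gt0 accP 0) opp_lim_coef_neq0.
(* The roots converge, so the upper and lower limits, hence both radii, coincide. *)
have [einfP esupP] := cvg_limn_einf_sup (cvg_root_coef tameP h_gt0 accP).
have radius : ((expR (- ln (cabs (opp_prod P h)) / h%:R))%:E^-1 ^+ h =
    (cabs (opp_prod P h))%:E)%E.
  rewrite inver gt_eqF ?expR_gt0 // -EFin_expe -expRN mulNr opprK -expRM_natl.
  by rewrite mulrC divfK ?pnatr_eq0 -?lt0n // lnK.
split; last first.
  by rewrite /r_radius /R_radius einfP esupP; split=> // e; exact: opp_lim_coefh.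
move=> e; have [? ?] := opp_lim_cvg_accumulation tameP h_gt0 accP e.
have fh := opp_lim_coefDh tameP h_gt0 accP e.
split=> //; last exact: size_opp_num.
  by rewrite opp_numE //; exact: fps_quotient_periodic.
by rewrite opp_numE //; exact: fps_converges_to_periodic.
Qed.
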